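(* Let $p,q\in\mathbb{C}$ with $q\ne 0$, and let $(u_m)_{m\in\mathbb{Z}}$ be the sequence with $u_0=0$, $u_1=1$ and $u_m=pu_{m-1}-qu_{m-2}$ for all $m\in\mathbb{Z}$. Let $n\in\mathbb{N}$, $n\ge 1$, be fixed and let $X:\mathbb{Z}\to\mathbb{C}$ be a product of $n$ functions $\mathbb{Z}\to\mathbb{C}$, each of which satisfies the recurrence $W_m=pW_{m-1}-qW_{m-2}$ for all $m\in\mathbb{Z}$. Suppose that $u_k=0$ for some $k$ with $1\le k\le n+1$. Then for all $r\in\mathbb{Z}$, $$X(k+r+1)=u_{k+1}^n\,X(r+1).$$
   Context: The $n$ functions in the product need not be distinct and may have different initial values (in $\mathbb{C}$). *)

(* Defs.v *)
From HB Require Import structures.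
From mathcomp Require Import all_boot all_order all_algebra.
From mathcomp Require Import reals.
From mathcomp Require Import complex.

Set Implicit Arguments.
Unset Strict Implicit.
Unset Printing Implicit Defensive.

Import Order.TTheory GRing.Theory Num.Theory.

Local Open Scope ring_scope.
Local Open Scope complex_scope.

Section Recurrence.

Variables (R : realType) (p q : R[i]).

Definition satisfies_recurrence (W : int -> R[i]) : Prop :=
  forall m : int, W m = p * W (m - 1) - q * W (m - 2).

(* As q != 0 is assumed in its uses, the recurrence runs in both directions
   and this determines u on all of int. *)
Definition fundamental_sequence (u : int -> R[i]) : Prop :=
  [/\ u 0 = 0, u 1 = 1 & satisfies_recurrence u].

(* The n factors may coincide and have arbitrary complex initial values. *)
Definition product_of_solutions (n : nat) (X : int -> R[i]) : Prop :=
  exists W : 'I_n -> int -> R[i],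
    (forall i, satisfies_recurrence (W i)) /\
    (forall m, X m = \prod_(i < n) W i m).

End Recurrence.

(* Main.v *)
Require Import Defs.
From HB Require Import structures.
From mathcomp Require Import all_boot all_order all_algebra.
From mathcomp Require Import reals.
From mathcomp Require Import complex.
From mathcomp Require Import ring.

(** Every single factor [W] already satisfies [W (k + m) = u (k + 1) * W m]
    for all [m]; multiplying this identity over the [n] factors produces the
    power [u (k + 1) ^+ n].

    The solutions of the recurrence form a vector space that is stable under
    translation, and a solution is determined by its values at 0 and 1, since
    [q != 0] lets the recurrence run backwards as well as forwards.  This gives
    [W m = W 1 * u m - q * W 0 * u (m - 1)] ([solution_fundamentalE]).  When
    [u k = 0], the recurrence for [u] reads [u (k + 1) = - q * u (k - 1)], so
    the formula yields [W k = u (k + 1) * W 0] and [W (k + 1) = u (k + 1) * W 1].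
    Thus the solutions [m |-> W (k + m)] and [m |-> u (k + 1) * W m] have the
    same values at 0 and 1, hence coincide ([solution_shift_zero]). *)

Set Implicit Arguments.
Unset Strict Implicit.
Unset Printing Implicit Defensive.

Import Order.TTheory GRing.Theory Num.Theory.

Local Open Scope ring_scope.
Local Open Scope complex_scope.

Lemma solution_shift (R : realType) (p q : R[i]) (W : int -> R[i]) (k : int) :
  satisfies_recurrence p q W ->
  satisfies_recurrence p q (fun m => W (k + m)).
Proof. by move=> hW m; rewrite (hW (k + m)) !addrA. Qed.

Lemma solution_lincomb (R : realType) (p q : R[i]) (V W : int -> R[i])
    (a b : R[i]) :
  satisfies_recurrence p q V -> satisfies_recurrence p q W ->
  satisfies_recurrence p q (fun m => a * V m + b * W m).
Proof. by move=> hV hW m; rewrite (hV m) (hW m); ring. Qed.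

(** Two consecutive zeros propagate to the right by the recurrence itself, and
    to the left because [q] can be cancelled. *)
Lemma solution_eq0 (R : realType) (p q : R[i]) (W : int -> R[i]) :
  q != 0 -> satisfies_recurrence p q W -> W 0 = 0 -> W 1 = 0 ->
  forall m, W m = 0.
Proof.
move=> q_neq0 hW W0 W1 m.
suff [] : W m = 0 /\ W (m + 1) = 0 by [].
elim/int_rect: m => [|j [Wj Wj1]|j [Wj Wj1]]; first by rewrite add0r.
- have -> : j.+1%:Z = j%:Z + 1 by rewrite -addn1 PoszD.
  split=> //; rewrite hW.
  have -> : j%:Z + 1 + 1 - 1 = j%:Z + 1 by ring.
  have -> : j%:Z + 1 + 1 - 2 = j%:Z by ring.
  by rewrite Wj Wj1 !mulr0 subr0.
- have -> : - j.+1%:Z = - j%:Z - 1 by rewrite -addn1 PoszD; ring.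
  rewrite subrK; split=> //.
  have := hW (- j%:Z + 1).
  have -> : - j%:Z + 1 - 1 = - j%:Z by ring.
  have -> : - j%:Z + 1 - 2 = - j%:Z - 1 by ring.
  rewrite Wj Wj1 mulr0 sub0r => /esym/eqP.
  by rewrite oppr_eq0 mulf_eq0 (negPf q_neq0) => /eqP.
Qed.

Lemma solution_unique (R : realType) (p q : R[i]) (V W : int -> R[i]) :
  q != 0 -> satisfies_recurrence p q V -> satisfies_recurrence p q W ->
  V 0 = W 0 -> V 1 = W 1 -> V =1 W.
Proof.
move=> q_neq0 hV hW VW0 VW1 m; apply/eqP; rewrite -subr_eq0; apply/eqP.
have := solution_eq0 q_neq0 (solution_lincomb 1 (-1) hV hW) _ _ m.
by rewrite VW0 VW1 !mul1r !mulN1r !subrr; apply.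
Qed.

(** The right-hand side is the solution with initial values [W 0] and [W 1],
    because [u (-1) = - q^-1]. *)
Lemma solution_fundamentalE (R : realType) (p q : R[i]) (u W : int -> R[i]) :
  q != 0 -> fundamental_sequence p q u -> satisfies_recurrence p q W ->
  forall m, W m = W 1 * u m - q * W 0 * u (- 1 + m).
Proof.
move=> q_neq0 [u0 u1 hu] hW.
have quN1 : q * u (-1) = -1.
  have := hu 1.
  have -> : 1 - 1 = 0 :> int by [].
  have -> : 1 - 2 = -1 :> int by [].
  by rewrite u0 u1 mulr0 sub0r => ->; rewrite opprK.
move=> m; rewrite -mulNr; move: m.
apply: (solution_unique q_neq0 hW).
- exact: solution_lincomb hu (solution_shift (-1) hu).
- by rewrite addr0 u0 mulr0 add0r mulNr mulrAC quN1 mulN1r opprK.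
- by rewrite addNr u0 u1 mulr0 addr0 mulr1.
Qed.

(** In the basis of initial values, translation by [k] is the matrix with rows
    [(- q * u (k - 1), u k)] and [(- q * u k, u (k + 1))]; when [u k = 0] its
    off-diagonal entries vanish and its diagonal entries agree. *)
Lemma solution_shift_zero (R : realType) (p q : R[i]) (u W : int -> R[i])
    (k : int) :
  q != 0 -> fundamental_sequence p q u -> satisfies_recurrence p q W ->
  u k = 0 -> forall m, W (k + m) = u (k + 1) * W m.
Proof.
move=> q_neq0 fu hW uk.
have WE := solution_fundamentalE q_neq0 fu hW.
have uk1 : u (k + 1) = - (q * u (- 1 + k)).
  have [_ _ hu] := fu; rewrite hu addrK uk mulr0 sub0r.
  by have -> : k + 1 - 2 = - 1 + k by ring.
apply: (solution_unique q_neq0 (solution_shift k hW)).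
- by move=> m; rewrite (hW m); ring.
- by rewrite addr0 WE uk uk1; ring.
- rewrite WE; have -> : - 1 + (k + 1) = k by ring.
  by rewrite uk mulr0 subr0 mulrC.
Qed.

Theorem proposition3p3 (R : realType) (p q : R[i]) (hq : q != 0)
    (u : int -> R[i]) (hu : fundamental_sequence p q u)
    (n : nat) (hn : (1 <= n)%N)
    (X : int -> R[i]) (hX : product_of_solutions p q n X)
    (k : int) (hk1 : 1 <= k) (hkn : k <= n%:Z + 1) (huk : u k = 0) :
  forall r : int, X (k + r + 1) = u (k + 1) ^+ n * X (r + 1).
Proof.
move=> r; have [W [hW XE]] := hX.
rewrite !XE -addrA.
under eq_bigr => i _ do rewrite (solution_shift_zero hq hu (hW i) huk).
by rewrite big_split prodr_const card_ord.
Qed.
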